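(* Let $(X,d,\mu)$ be a metric measure space satisfying the doubling condition: there are $C,D>0$ with $\mu(B(x,R))\le C(R/r)^D\mu(B(x,r))$ for all $x\in X$, $0<r\le R$. Let $L$ be a non-negative self-adjoint operator on $L^2(\mu)$ such that the integral kernel $T_t(x,y)$ of the semigroup $T_t=e^{-tL}$ satisfies, for some $C,c>0$, $$0\le T_t(x,y)\le C\,\mu(B(x,\sqrt t))^{-1}\exp\left(-\frac{d(x,y)^2}{ct}\right),\qquad t>0,\ x,y\in X.$$ If $h$ is a bounded $L$-harmonic function (for all $t>0$, $T_th(x)=h(x)$ for a.e. $x\in X$), then $$\int_X f(x)h(x)\,d\mu(x)=0\qquad\text{for every } f\in H^1_L(X).$$
   Context: $B(x,r)=\{y\in X: d(x,y)<r\}$. $T_th(x)=\int_XT_t(x,y)h(y)\,d\mu(y)$. Hardy space: for $f\in L^2(\mu)$ put $\|f\|_{H^1_L(X)}=\|\sup_{t>0}|T_tf|\,\|_{L^1(\mu)}$; $H^1_L(X)$ is the completion of $\{f\in L^2(\mu):\|f\|_{H^1_L(X)}<\infty\}$ in this norm; it embeds continuously in $L^1(\mu)$ and is regarded as a subspace of $L^1(\mu)$.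
   Formalization: The formal theorem adds the hypothesis μ(X)=∞; without it the claim fails (X a point, L=0, f=h=1), and for μ(X)<∞ it holds only when h=0 a.e. *)

(* Defs.v *)
From HB Require Import structures.
From mathcomp Require Import all_boot all_order all_algebra.
From mathcomp Require Import all_classical all_reals all_analysis.

Set Implicit Arguments.
Unset Strict Implicit.
Unset Printing Implicit Defensive.

Import Order.TTheory GRing.Theory Num.Theory.
Import numFieldNormedType.Exports.

Local Open Scope classical_set_scope.
Local Open Scope ring_scope.

HB.mixin Record isBorelMetric (R : realType) (d : measure_display) X
    & Measurable d X & Metric R X := {
  measurable_borel : @measurable d X = <<s @open X >>
}.

#[short(type="borelMetricType")]
HB.structure Definition BorelMetric (R : realType) (d : measure_display) :=
  { X of Measurable d X & Metric R X & isBorelMetric R d X }.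

Section metric_measure_space.
Context (R : realType) (d : measure_display) (X : borelMetricType R d).
Variable mu : {measure set X -> \bar R}.

(* Convention for a metric measure space; the factor mu(B(x, sqrt t))^-1 of
   the Gaussian bound only makes sense under it. *)
Definition finite_positive_balls :=
  forall (x : X) (r : R), 0 < r -> (0 < mu (ball x r) < +oo)%E.

Definition doubling := exists C D : R, [/\ 0 < C, 0 < D &
  forall (x : X) (r s : R), 0 < r -> r <= s ->
    (mu (ball x s) <= (C * (s / r) `^ D)%:E * mu (ball x r))%E].

End metric_measure_space.

(* Elements of L^2(mu) are represented by functions in [Lfun mu 2%:E]; the
   identification of functions that agree almost everywhere is made explicit. *)
Section L2_operators.
Context (R : realType) (d : measure_display) (X : measurableType d).
Variable mu : {measure set X -> \bar R}.

Local Notation L2 := (Lfun mu 2%:E).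
Local Notation "'N2[ f ]" := ('N[mu]_2%:E [EFin \o f%R])%E.

Definition dotL2 (f g : X -> R) : R := \int[mu]_x (f x * g x).

(* An unbounded operator L is given by its graph: [L f g] means that f belongs
   to the domain of L and that L f = g. *)
Record is_operator (L : (X -> R) -> (X -> R) -> Prop) : Prop := IsOperator {
  operator_L2 : forall f g, L f g -> f \in L2 /\ g \in L2 ;
  operator_ae : forall f g f' g', L f g -> f' \in L2 -> g' \in L2 ->
    f = f' %[ae mu] -> g = g' %[ae mu] -> L f' g' ;
  operator_fun : forall f g g', L f g -> L f g' -> g = g' %[ae mu] ;
  operator_lin : forall a f g f' g', L f g -> L f' g' ->
    L (fun x => a * f x + f' x) (fun x => a * g x + g' x)
}.

Definition densely_defined (L : (X -> R) -> (X -> R) -> Prop) :=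
  forall f, f \in L2 -> forall e : R, 0 < e ->
    exists g Lg, L g Lg /\ ('N2[f \- g] < e%:E)%E.

Definition adjoint (L : (X -> R) -> (X -> R) -> Prop) (f g : X -> R) : Prop :=
  [/\ f \in L2, g \in L2 & forall u Lu, L u Lu -> dotL2 Lu f = dotL2 u g].

Definition selfadjoint (L : (X -> R) -> (X -> R) -> Prop) :=
  [/\ is_operator L, densely_defined L &
      forall f g, L f g <-> adjoint L f g].

Definition nonnegative (L : (X -> R) -> (X -> R) -> Prop) :=
  forall f Lf, L f Lf -> 0 <= dotL2 Lf f.

(* [S t] is only meaningful for 0 <= t. *)
Record C0_semigroup (S : R -> (X -> R) -> (X -> R)) : Prop := C0Semigroup {
  semigroup_L2 : forall t f, 0 <= t -> f \in L2 -> S t f \in L2 ;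
  semigroup_lin : forall t a f g, 0 <= t -> f \in L2 -> g \in L2 ->
    S t (fun x => a * f x + g x) = (fun x => a * S t f x + S t g x) %[ae mu] ;
  semigroup_bounded : forall t, 0 <= t -> exists M : R,
    forall f, f \in L2 -> ('N2[S t f] <= M%:E * 'N2[f])%E ;
  semigroup0 : forall f, f \in L2 -> S 0 f = f %[ae mu] ;
  semigroupD : forall s t f, 0 <= s -> 0 <= t -> f \in L2 ->
    S (s + t) f = S s (S t f) %[ae mu] ;
  semigroup_cont0 : forall f, f \in L2 ->
    'N2[S t f \- f] @[t --> 0^'+] --> 0%E
}.

(* S = (e^{-tL})_{t >= 0}: the strongly continuous semigroup on L^2(mu) whose
   infinitesimal generator, domain included, is -L. *)
Definition exp_semigroup (L : (X -> R) -> (X -> R) -> Prop)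
    (S : R -> (X -> R) -> (X -> R)) :=
  C0_semigroup S /\
  forall f g, L f g <-> [/\ f \in L2, g \in L2 &
    'N2[fun x => t^-1 * (S t f x - f x) + g x] @[t --> 0^'+] --> 0%E].

End L2_operators.

Section hardy.
Context (R : realType) (d : measure_display) (X : borelMetricType R d).
Variables (mu : {measure set X -> \bar R}) (T : R -> X -> X -> R).

Definition kernel_op (t : R) (f : X -> R) (x : X) : R :=
  \int[mu]_y (T t x y * f y).

Definition integral_kernel (S : R -> (X -> R) -> (X -> R)) :=
  forall t : R, 0 < t ->
    measurable_fun [set: X * X] (fun p => T t p.1 p.2) /\
    forall f, f \in Lfun mu 2%:E -> S t f = kernel_op t f %[ae mu].

Definition gaussian_bound := exists C c : R, [/\ 0 < C, 0 < c &
  forall (t : R) (x y : X), 0 < t ->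
    0 <= T t x y <= C * (fine (mu (ball x (Num.sqrt t))))^-1 *
                    expR (- (mdist x y ^+ 2 / (c * t)))].

Definition L_harmonic (h : X -> R) :=
  measurable_fun [set: X] h /\
  forall t : R, 0 < t -> kernel_op t h = h %[ae mu].

Definition semigroup_maximal (f : X -> R) (x : X) : \bar R :=
  ereal_sup [set `|kernel_op t f x|%:E | t in [set t : R | 0 < t]].

Definition hardy_norm (f : X -> R) : \bar R := (\int[mu]_x semigroup_maximal f x)%E.

Definition prehardy (f : X -> R) :=
  f \in Lfun mu 2%:E /\ (hardy_norm f < +oo)%E.

(* The completion of [prehardy] for [hardy_norm], regarded as a subspace of
   L^1(mu): the L^1-limits of the [hardy_norm]-Cauchy sequences. *)
Definition hardy (f : X -> R) :=
  f \in Lfun mu 1%E /\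
  exists u : nat -> X -> R,
    [/\ forall n, prehardy (u n),
        forall e : R, 0 < e -> exists N : nat, forall m n : nat,
          (N <= m)%N -> (N <= n)%N -> (hardy_norm (u m \- u n)%R < e%:E)%E
      & 'N[mu]_1 [EFin \o (u n \- f)%R]%E @[n --> \oo] --> 0%E].

End hardy.

(* Main.v *)
(* Self-adjointness moves the semigroup from h to f in int f h = int f (T_t h),
   so |int f h| <= ||h||_oo ||T_t f||_1 for all t > 0. When f has an integrable
   maximal function and lies in L^1, T_t f tends to 0 in L^1 as t -> oo: the
   Gaussian bound gives |T_t f(x)| <= C ||f||_1 / mu(B(x, sqrt t)) -> 0 because
   mu(X) = oo, and the maximal function dominates. General f follow by
   L^1-approximation.

   That e^{-tL} is symmetric follows from the generator alone, without spectral
   theory: for f, g in the domain the difference <S_t f, g> - <f, S_t g>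
   telescopes along <S_{(n-k)t/n} f, S_{kt/n} g>, each term being o(1/n) uniformly in k.
   The uniform operator bound needed there is Schur's test, whose hypotheses
   follow from the Gaussian bound and doubling by summing over shells. *)

Require Import Defs.
From HB Require Import structures.
From mathcomp Require Import all_boot all_order all_algebra.
From mathcomp Require Import all_classical all_reals all_analysis.
From mathcomp Require Import measurable_realfun ring lra.

Set Implicit Arguments.
Unset Strict Implicit.
Unset Printing Implicit Defensive.

Import Order.TTheory GRing.Theory Num.Theory.
Import numFieldNormedType.Exports.

Local Open Scope classical_set_scope.
Local Open Scope ring_scope.

(** * Nonnegative extended-real limits at zero *)

Lemma cvge0_lt (R : realType) (I : Type) (F : set_system I) (FF : Filter F)
    (u : I -> \bar R) (e : R) :
  0 < e -> u i @[i --> F] --> 0%E -> \forall i \near F, (u i < e%:E)%E.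
Proof.
move=> e0 /(_ [set y | (y < e%:E)%E]); apply.
apply: open_nbhs_nbhs; split; first exact: open_ereal_lt_ereal.
by rewrite /= lte_fin.
Qed.

(** * The space L^2 *)

Section L2_facts.
Context (R : realType) (d : measure_display) (X : measurableType d).
Variable mu : {measure set X -> \bar R}.
Local Notation L2 := (Lfun mu 2%:E).
Local Notation "'N2[ f ]" := ('N[mu]_2%:E [EFin \o f%R])%E.
Implicit Types (f g : X -> R) (a : R).

Lemma LfunE f (p : \bar R) :
  f \in Lfun mu p <-> measurable_fun setT f /\ ('N[mu]_p [EFin \o f] < +oo)%E.
Proof.
split; first by rewrite inE => /andP[]; rewrite !inE.
by move=> [mf ff]; rewrite inE; apply/andP; split; rewrite inE.
Qed.

Lemma Lfun_measurable f (p : \bar R) : f \in Lfun mu p -> measurable_fun setT f.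
Proof. by move=> /LfunE[]. Qed.

Lemma ae_eq_Lnorm (p : R) f g :
  measurable_fun setT f -> measurable_fun setT g -> f = g %[ae mu] ->
  ('N[mu]_p%:E [EFin \o f] = 'N[mu]_p%:E [EFin \o g])%E.
Proof.
move=> mf mg fg; rewrite unlock; congr (_ `^ _)%E.
have mp (k : X -> R) : measurable_fun setT k ->
    measurable_fun setT (fun x => `|k x| `^ p).
  move=> mk; apply: (measurableT_comp (measurable_powR _)).
  exact: measurableT_comp.
apply: ae_eq_integral => //; [exact/measurable_EFinP/mp|exact/measurable_EFinP/mp|].
by apply: filterS fg => x /= /[apply] ->.
Qed.

Definition nrm2 f : R := fine 'N2[f].

Lemma nrm2E f : f \in L2 -> (nrm2 f)%:E = 'N2[f].
Proof. by move=> /LfunE[_ fy]; rewrite /nrm2 fineK// ge0_fin_numE// Lnorm_ge0. Qed.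

Lemma nrm2_ge0 f : 0 <= nrm2 f.
Proof. by rewrite fine_ge0// Lnorm_ge0. Qed.

Lemma L2_lin a f g : f \in L2 -> g \in L2 -> (fun x => a * f x + g x) \in L2.
Proof.
move=> f2 g2; have -> : (fun x => a * f x + g x) = a *: f + g by [].
have h : (1 <= 2%:E :> \bar R)%E by rewrite lee_fin ler1n.
rewrite -[f](Lfun_valP h f2) -[g](Lfun_valP h g2).
exact: (LfunP (a *: Lfun_Sub h f2 + Lfun_Sub h g2)).
Qed.

Lemma L2B f g : f \in L2 -> g \in L2 -> f \- g \in L2.
Proof.
move=> f2 g2; have -> : f \- g = fun x => -1 * g x + f x.
  by apply/funext => x /=; rewrite mulN1r addrC.
exact: L2_lin.
Qed.

Lemma dotL2C f g : dotL2 mu f g = dotL2 mu g f.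
Proof. by rewrite /dotL2; under eq_Rintegral do rewrite mulrC. Qed.

Lemma dotL2_lin a f g k : f \in L2 -> g \in L2 -> k \in L2 ->
  dotL2 mu (fun x => a * f x + g x) k = a * dotL2 mu f k + dotL2 mu g k.
Proof.
move=> f2 g2 k2; rewrite /dotL2.
have ifk := (Lfun1_integrable mu _).1 (Lfun2_mul_Lfun1 f2 k2).
have igk := (Lfun1_integrable mu _).1 (Lfun2_mul_Lfun1 g2 k2).
under eq_Rintegral do rewrite mulrDl -mulrA.
rewrite (@RintegralD _ _ _ mu _ (fun x => a * (f x * k x)))//; first by rewrite RintegralZl.
exact: (integrableZl measurableT a ifk).
Qed.

Lemma ae_eq_dotL2 f f' g : measurable_fun setT f -> measurable_fun setT f' ->
  measurable_fun setT g -> f = f' %[ae mu] -> dotL2 mu f g = dotL2 mu f' g.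
Proof.
move=> mf mf' mg ff'; rewrite /dotL2 /Rintegral; congr fine.
apply: ae_eq_integral => //.
- by apply/measurable_EFinP; exact: measurable_funM.
- by apply/measurable_EFinP; exact: measurable_funM.
- by apply: filterS ff' => x /= /[apply] ->.
Qed.

Lemma cauchy_schwarz f g : f \in L2 -> g \in L2 ->
  `|dotL2 mu f g| <= nrm2 f * nrm2 g.
Proof.
move=> f2 g2.
have ifg := (Lfun1_integrable mu _).1 (Lfun2_mul_Lfun1 f2 g2).
apply: (le_trans (le_normr_Rintegral _ ifg)) => //.
rewrite -lee_fin EFinM !nrm2E// /Rintegral fineK.
  have := hoelder mu (f := f) (g := g) (p := 2) (q := 2)
    (Lfun_measurable f2) (Lfun_measurable g2).
  by rewrite Lnorm1; apply => //; rewrite [RHS]splitr !div1r.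
have /integrableP[_] := integrable_abse ifg.
move=> h; rewrite ge0_fin_numE ?integral_ge0//.
by apply: le_lt_trans h; under [leRHS]eq_integral do rewrite abse_id.
Qed.

Lemma dotL2E f g : f \in L2 -> g \in L2 ->
  ((dotL2 mu f g)%:E = \int[mu]_x (f x * g x)%:E)%E.
Proof.
move=> f2 g2; rewrite /dotL2 /Rintegral fineK//.
apply: integrable_fin_num => //.
exact: ((Lfun1_integrable mu _).1 (Lfun2_mul_Lfun1 f2 g2)).
Qed.

Lemma nrm2_sqrE f : f \in L2 ->
  ((nrm2 f ^+ 2)%:E = \int[mu]_x (f x ^+ 2)%:E)%E.
Proof.
move=> f2; have := poweR_Lnorm mu (EFin \o f) (r := 2); rewrite -nrm2E//.
rewrite poweR_EFin powR_mulrn ?nrm2_ge0// => -> //.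
by apply: eq_integral => x _; rewrite /= powR_mulrn// real_normK// num_real.
Qed.

End L2_facts.

Lemma fine_cvge0_lt (R : realType) (I : Type) (F : set_system I) (FF : Filter F)
    (u : I -> \bar R) (e : R) : (forall i, (0 <= u i)%E) ->
  0 < e -> u i @[i --> F] --> 0%E -> \forall i \near F, fine (u i) < e.
Proof.
move=> u0 e0 u_0; apply: filterS (cvge0_lt FF e0 u_0) => i uie.
by rewrite -lte_fin fineK// ge0_fin_numE// (lt_trans uie) ?ltry.
Qed.

(** Turns smallness as the time step tends to 0 into smallness for some equal subdivision of [0, t],
    as the telescoping argument requires. *)
Lemma near0_divnS (R : realType) (t : R) (P : R -> Prop) : 0 < t ->
  (\forall h \near 0^'+, P h) -> exists n, P (t / n.+1%:R).
Proof.
(* With n the integer part of t/e, n + 1 > t/e, hence t/(n+1) < e. *)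
move=> t0 [e /= e0 eP]; exists (Num.truncn (t / e)).
have n0 : 0 < t / (Num.truncn (t / e)).+1%:R by rewrite divr_gt0.
apply: eP => //=; rewrite sub0r normrN gtr0_norm// ltr_pdivrMr// mulrC.
by rewrite -ltr_pdivrMr// truncnS_gt.
Qed.

(** * Symmetry of the semigroup generated by a self-adjoint operator *)

Section symmetric_semigroup.
Context (R : realType) (d : measure_display) (X : measurableType d).
Variable mu : {measure set X -> \bar R}.
Local Notation L2 := (Lfun mu 2%:E).
Local Notation "'N2[ f ]" := ('N[mu]_2%:E [EFin \o f%R])%E.
Local Notation dot := (dotL2 mu).
Local Notation n2 := (nrm2 mu).
Variables (L : (X -> R) -> (X -> R) -> Prop) (S : R -> (X -> R) -> (X -> R)).
Hypotheses (Lself : selfadjoint mu L) (SL : exp_semigroup mu L S).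
Variable K : R.
Hypothesis SK : forall t f, 0 <= t -> f \in L2 -> n2 (S t f) <= K * n2 f.

Let Csg := SL.1.
Let SL2 := semigroup_L2 Csg.
Let Lfm := @Lfun_measurable R d X mu.

(** The error of the difference quotient against its limit -Lf; for f in the domain it tends to 0 in
    L^2 as t -> 0+. *)
Definition generator_defect (t : R) (f Lf : X -> R) (x : X) : R :=
  t^-1 * (S t f x - f x) + Lf x.

Lemma generator_defect_L2 t f Lf : 0 <= t -> f \in L2 -> Lf \in L2 ->
  generator_defect t f Lf \in L2.
Proof. by move=> t0 f2 Lf2; apply: L2_lin => //; apply: L2B => //; exact: SL2. Qed.

Lemma generator_defect_small f Lf (e : R) : L f Lf -> 0 < e ->
  \forall t \near 0^'+, n2 (generator_defect t f Lf) < e.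
Proof.
move=> /(SL.2 _ _).1[f2 Lf2 cf] e0.
by apply: (fine_cvge0_lt _ _ e0 cf) => t; rewrite Lnorm_ge0.
Qed.

(** [S s] commutes with difference quotients, so the defect of S_s f is S_s applied to the defect of
    f, and the bound [K] carries the convergence over. *)
Lemma generator_semigroup s f Lf : 0 <= s -> L f Lf -> L (S s f) (S s Lf).
Proof.
move=> s0 LfLf; have /(SL.2 _ _).1[f2 Lf2 cf] := LfLf.
apply/(SL.2 _ _).2; split; [exact: SL2|exact: SL2|].
have key t : 0 < t ->
    ('N2[fun x => t^-1 * (S t (S s f) x - S s f x) + S s Lf x]
      <= K%:E * 'N2[generator_defect t f Lf])%E.
  move=> t0; have t0' := ltW t0.
  have e2 := generator_defect_L2 t0' f2 Lf2.
  rewrite -(nrm2E e2) -EFinM.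
  have := SK s0 e2; rewrite -lee_fin nrm2E; last exact: SL2.
  move=> /(le_trans _); apply; rewrite le_eqVlt; apply/orP; left; apply/eqP.
  have ef2 := SL2 s0 f2; have eLf2 := SL2 s0 Lf2.
  apply: ae_eq_Lnorm.
  - by apply: Lfm; apply: L2_lin => //; apply: L2B => //; exact: SL2.
  - by apply: Lfm; exact: SL2.
  - have h1 := semigroup_lin Csg t^-1 s0 (L2B (SL2 t0' f2) f2) Lf2.
    have eB : S t f \- f = fun x => -1 * f x + S t f x.
      by apply/funext => x /=; rewrite mulN1r addrC.
    have h2 := semigroup_lin Csg (-1) s0 f2 (SL2 t0' f2).
    have h3 : S t (S s f) = S s (S t f) %[ae mu].
      apply: filterS2 (semigroupD Csg s0 t0' f2) (semigroupD Csg t0' s0 f2).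
      by move=> x h3 h4 _; rewrite -(h3 I) -(h4 I) addrC.
    apply: filterS3 h1 h2 h3 => x h1 h2 h3 _.
    by rewrite [RHS](h1 I) eB (h2 I) (h3 I) mulN1r [- _ + _]addrC.
rewrite -[X in _ --> X](mule0 K%:E).
apply: (@squeeze_cvge _ _ _ _ (fun=> 0%E) _ (fun t => K%:E * 'N2[generator_defect t f Lf])%E).
- near=> t; rewrite Lnorm_ge0/=; apply: key; near: t; exact: nbhs_right_gt.
- by rewrite mule0; exact: cvg_cst.
- exact: cvgeZl.
Unshelve. all: by end_near. Qed.

Lemma generator_symmetric f Lf g Lg : L f Lf -> L g Lg -> dot Lf g = dot f Lg.
Proof.
move=> LfLf LgLg; have [_ _ /(_ g Lg)[/(_ LgLg)[g2 Lg2 /(_ _ _ LfLf) //]]] := Lself.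
Qed.

(** First-order expansion in time, from S_h f = f - h Lf + h (defect). The remainder is o(h)
    uniformly in [p] because S_p is bounded by [K] for every p. *)
Lemma semigroup_step p h f Lf v : 0 <= p -> 0 < h -> L f Lf -> v \in L2 ->
  `|dot (S (p + h) f) v - (dot (S p f) v - h * dot (S p Lf) v)|
    <= h * (K * n2 (generator_defect h f Lf) * n2 v).
Proof.
move=> p0 h0 LfLf v2; have /(SL.2 _ _).1[f2 Lf2 cf] := LfLf.
have h0' := ltW h0; have e2 := generator_defect_L2 h0' f2 Lf2.
have w2 := L2_lin (- h) Lf2 f2.
have -> : dot (S (p + h) f) v =
    dot (fun x => h * S p (generator_defect h f Lf) x + (- h * S p Lf x + S p f x)) v.
  apply: ae_eq_dotL2.
  - by apply: Lfm; apply: SL2 => //; exact: addr_ge0.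
  - by apply: Lfm; do 2 (apply: L2_lin; [exact: SL2|]); exact: SL2.
  - exact: Lfm v2.
  - have h1 := semigroup_lin Csg h p0 e2 w2.
    have h2 := semigroup_lin Csg (- h) p0 Lf2 f2.
    have h3 := semigroupD Csg p0 h0' f2.
    have eS : S h f = fun x => h * generator_defect h f Lf x + (- h * Lf x + f x).
      by apply/funext => x; rewrite /generator_defect; field; rewrite gt_eqF.
    apply: filterS3 h1 h2 h3 => x h1 h2 h3 _.
    by rewrite (h3 I) eS (h1 I) (h2 I).
rewrite !dotL2_lin//; try exact: SL2; last by apply: L2_lin; exact: SL2.
rewrite [X in `|X|](_ : _ = h * dot (S p (generator_defect h f Lf)) v); last by ring.
rewrite normrM gtr0_norm// ler_pM2l//.
apply: (le_trans (cauchy_schwarz _ v2)); first exact: SL2.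
by rewrite ler_wpM2r ?nrm2_ge0// SK.
Qed.

(** Two consecutive telescoping terms advance either f or g by h from the same pair (S_p f, S_q g).
    Symmetry of L makes their first-order parts equal, so only the remainders survive. *)
Lemma semigroup_symmetric_domain t f Lf g Lg : 0 < t -> L f Lf -> L g Lg ->
  dot (S t f) g = dot f (S t g).
Proof.
move=> t0 LfLf LgLg.
have /(SL.2 _ _).1[f2 Lf2 _] := LfLf; have /(SL.2 _ _).1[g2 Lg2 _] := LgLg.
(* Collects the two remainder bounds. The 1 makes B positive, so that division by it is allowed; the
   absolute value is there because no sign is assumed for [K]. *)
pose B := 1 + `|K| * (`|K| * n2 g + `|K| * n2 f).
have B0 : 0 < B by rewrite ltr_pwDl// mulr_ge0// addr_ge0// mulr_ge0// nrm2_ge0.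
apply/eqP; rewrite -subr_eq0 -normr_le0; apply/ler_addgt0Pl => e e0; rewrite addr0.
(* The n + 1 steps, each costing h e' B with (n+1) h = t, then add up to exactly e. *)
pose e' := e / (t * B).
have e'0 : 0 < e' by rewrite divr_gt0// mulr_gt0.
have [n [fe ge]] : exists n, n2 (generator_defect (t / n.+1%:R) f Lf) < e' /\
    n2 (generator_defect (t / n.+1%:R) g Lg) < e'.
  apply: (near0_divnS (P := fun h => n2 (generator_defect h f Lf) < e' /\
    n2 (generator_defect h g Lg) < e')) => //.
  apply: filterS2 (generator_defect_small LfLf e'0)
    (generator_defect_small LgLg e'0) => h.
  by split.
set h := t / n.+1%:R in fe ge.
have h0 : 0 < h by rewrite divr_gt0.
have hn k : 0 <= h * k%:R by rewrite mulr_ge0// ltW.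
pose a k := dot (S (h * (n.+1 - k)%:R) f) (S (h * k%:R) g).
(* At both ends one factor is acted on by [S 0], which is the identity only almost everywhere. *)
have a0 : a 0%N = dot (S t f) g.
  rewrite /a subn0 mulr0 mulfVK ?pnatr_eq0// [LHS]dotL2C [RHS]dotL2C.
  apply: ae_eq_dotL2;
    [apply: Lfm; exact: SL2|by apply: Lfm; eassumption| |exact: (semigroup0 Csg)].
  by apply: Lfm; apply: SL2 => //; exact: ltW.
have an : a n.+1 = dot f (S t g).
  rewrite /a subnn mulr0 mulfVK ?pnatr_eq0//.
  apply: ae_eq_dotL2;
    [apply: Lfm; exact: SL2|by apply: Lfm; eassumption| |exact: (semigroup0 Csg)].
  by apply: Lfm; apply: SL2 => //; exact: ltW.
have step k : (k < n.+1)%N -> `|a k.+1 - a k| <= h * e' * B.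
  move=> kn; set p := h * (n.+1 - k.+1)%:R; set q := h * k%:R.
  have p0 : 0 <= p by exact: hn.
  have q0 : 0 <= q by exact: hn.
  (* Both neighbours are expanded around (p, q): [a k] moves f by h, [a k.+1] moves g by h. *)
  have ak : a k = dot (S (p + h) f) (S q g).
    rewrite /a -/q; congr dot; congr S.
    by rewrite /p -[in RHS](mulr1 h) -mulrA mul1r -mulrDr natr1 -subSn.
  have ak1 : a k.+1 = dot (S (q + h) g) (S p f).
    rewrite /a -/p dotL2C; congr dot; congr S.
    by rewrite /q -[in RHS](mulr1 h) -mulrA mul1r -mulrDr natr1.
  have pf := SL2 p0 f2; have qg := SL2 q0 g2.
  have := semigroup_step p0 h0 LfLf qg; rewrite -ak => sf.
  have := semigroup_step q0 h0 LgLg pf; rewrite -ak1 => sg.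
  (* L S_p f = S_p Lf and likewise for g, so symmetry of L identifies the two first-order terms. *)
  have sym : dot (S p Lf) (S q g) = dot (S q Lg) (S p f).
    rewrite [RHS]dotL2C; apply: generator_symmetric; exact: generator_semigroup.
  rewrite (dotL2C _ (S q g)) -sym in sg.
  have n2S r u : 0 <= r -> u \in L2 -> n2 (S r u) <= `|K| * n2 u.
    move=> r0 u2; apply: (le_trans (SK r0 u2)).
    by rewrite ler_wpM2r ?nrm2_ge0// ler_norm.
  have bound r u v : r < e' -> 0 <= r -> u \in L2 ->
    n2 v <= `|K| * n2 u -> K * r * n2 v <= e' * (`|K| * (`|K| * n2 u)).
    move=> re r0 u2 vu; apply: (@le_trans _ _ (`|K| * e' * n2 v)).
      rewrite ler_wpM2r ?nrm2_ge0//; apply: (@le_trans _ _ (`|K| * r)).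
        by rewrite ler_wpM2r// ler_norm.
      by rewrite ler_wpM2l// ltW.
    by rewrite [`|K| * e']mulrC -mulrA !ler_wpM2l// ltW.
  have bf : K * n2 (generator_defect h f Lf) * n2 (S q g) <= e' * (`|K| * (`|K| * n2 g)).
    by apply: bound => //; [exact: nrm2_ge0|exact: n2S].
  have bg : K * n2 (generator_defect h g Lg) * n2 (S p f) <= e' * (`|K| * (`|K| * n2 f)).
    by apply: bound => //; [exact: nrm2_ge0|exact: n2S].
  have hbf := ler_wpM2l (ltW h0) bf; have hbg := ler_wpM2l (ltW h0) bg.
  have he'0 : 0 <= h * e' by rewrite ltW// mulr_gt0.
  rewrite ler_norml /B; move: sf sg; rewrite !ler_norml => /andP[? ?] /andP[? ?].
  by apply/andP; split; nra.
rewrite -a0 -an distrC -telescope_sumr//.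
apply: (le_trans (ler_norm_sum _ _ _)).
apply: (@le_trans _ _ (\sum_(0 <= i < n.+1) h * e' * B)).
  by rewrite !big_nat; apply: ler_sum => i /andP[_ ?]; exact: step.
rewrite sumr_const_nat subn0 -mulr_natr.
rewrite le_eqVlt; apply/orP; left; apply/eqP; rewrite /h /e'; field.
by rewrite !gt_eqF//= ltr0n.
Qed.

(** Write f = w + u with u in the domain and w small in L^2. The part in u is symmetric by
    hypothesis, and both pairings with w are at most |K| |w| |g| by Cauchy-Schwarz. It serves once
    for each argument of the pairing. *)
Lemma semigroup_symmetric_dense t f g : 0 < t -> f \in L2 -> g \in L2 ->
  (forall u Lu, L u Lu -> dot (S t u) g = dot u (S t g)) ->
  dot (S t f) g = dot f (S t g).
Proof.
move=> t0 f2 g2 Lsym; have t0' := ltW t0; have [_ Ldense _] := Lself.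
pose B := 1 + (`|K| * n2 g + `|K| * n2 g).
have B0 : 0 < B by rewrite ltr_pwDl// addr_ge0// mulr_ge0// nrm2_ge0.
apply/eqP; rewrite -subr_eq0 -normr_le0; apply/ler_addgt0Pl => e e0; rewrite addr0.
have [u [Lu [LuLu]]] := Ldense f f2 (e / B) (divr_gt0 e0 B0).
have /(SL.2 _ _).1[u2 _ _] := LuLu.
have w2 := L2B f2 u2; set w := f \- u in w2 *.
rewrite -(nrm2E w2) lte_fin => we.
have fE : f = fun x => 1 * w x + u x.
  by apply/funext => x; rewrite /w /= mul1r subrK.
have -> : dot (S t f) g = dot (S t w) g + dot (S t u) g.
  rewrite -[X in X + _]mul1r -dotL2_lin//; [|exact: SL2|exact: SL2].
  apply: ae_eq_dotL2.
  - by apply: Lfm; exact: SL2.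
  - by apply: Lfm; apply: L2_lin; exact: SL2.
  - exact: Lfm g2.
  - have := semigroup_lin Csg 1 t0' w2 u2; rewrite -fE; exact.
have -> : dot f (S t g) = dot w (S t g) + dot u (S t g).
  by rewrite {1}fE dotL2_lin ?mul1r//; exact: SL2.
rewrite (Lsym _ _ LuLu) [X in `|X|](_ : _ = dot (S t w) g - dot w (S t g)); last by ring.
apply: (le_trans (ler_normB _ _)).
have c1 := cauchy_schwarz (SL2 t0' w2) g2.
have c2 := cauchy_schwarz w2 (SL2 t0' g2).
apply: (le_trans (lerD c1 c2)).
have b (v : X -> R) : v \in L2 -> n2 (S t v) <= `|K| * n2 v.
  by move=> v2; rewrite (le_trans (SK t0' v2))// ler_wpM2r ?nrm2_ge0// ler_norm.
apply: (@le_trans _ _ (n2 w * B)); last by rewrite -ler_pdivlMr// ltW.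
have := ler_wpM2r (nrm2_ge0 mu g) (b _ w2).
have := ler_wpM2l (nrm2_ge0 mu w) (b _ g2).
have := nrm2_ge0 mu w.
rewrite /B; lra.
Qed.

Lemma semigroup_symmetric t f g : 0 < t -> f \in L2 -> g \in L2 ->
  dot (S t f) g = dot f (S t g).
Proof.
move=> t0 f2 g2; apply: semigroup_symmetric_dense => // u Lu LuLu.
have /(SL.2 _ _).1[u2 _ _] := LuLu.
rewrite dotL2C [RHS]dotL2C; apply/esym/semigroup_symmetric_dense => // v Lv LvLv.
exact: semigroup_symmetric_domain LvLv LuLu.
Qed.

End symmetric_semigroup.

(** * Series and exponential estimates for sums over shells *)

Lemma nneseries_le_geometric (R : realType) (u : nat -> \bar R) (a q : R) :
  0 <= a -> 0 < q < 1 -> (forall k, (0 <= u k <= (a * q ^+ k)%:E)%E) ->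
  (\sum_(0 <= k <oo) u k <= (a / (1 - q))%:E)%E.
Proof.
move=> a0 /andP[q0 q1] ub.
apply: lime_le; first by apply: is_cvg_nneseries => k _ _; case/andP: (ub k).
apply: nearW => n; apply: (@le_trans _ _ (\sum_(0 <= k < n) (a * q ^+ k)%:E)%E).
  by apply: lee_sum => k _; case/andP: (ub k).
rewrite sumEFin lee_fin; apply: geometric_le_lim => //.
by rewrite gtr0_norm.
Qed.

(* Completing the square: the polynomial growth loses to the Gaussian decay,
   with room left for a geometric factor. *)
Lemma powR_gauss_le (R : realType) (D c : R) : 0 < D -> 0 < c ->
  exists2 A : R, 0 < A & forall k : nat,
    (k.+2%:R `^ D) * expR (- (k%:R ^+ 2 / c)) <= A * expR (-1) ^+ k.
Proof.
move=> D0 c0; exists (expR (D + c * (D + 1) ^+ 2 / 4)); first exact: expR_gt0.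
move=> k; have k2 : 0 < k.+2%:R :> R by rewrite ltr0n.
rewrite -expRM_natl -expRD /powR gt_eqF// -expRD ler_expR.
have lnk : ln k.+2%:R <= k.+1%:R :> R.
  by rewrite -[k.+2%:R]natr1 addrC le_ln1Dx// (lt_le_trans (ltrN10 R)).
have := ler_wpM2l (ltW D0) lnk.
have h : 0 <= (c * (D + 1) / 2 - k%:R) ^+ 2 / c by rewrite divr_ge0 ?sqr_ge0// ltW.
have e : (c * (D + 1) / 2 - k%:R) ^+ 2 / c =
    c * (D + 1) ^+ 2 / 4 - (D + 1) * k%:R + k%:R ^+ 2 / c.
  by field; rewrite gt_eqF.
rewrite e in h; rewrite -natr1 mulrN1; nra.
Qed.

(** * Integrals of Gaussian kernels over doubling spaces *)

Section gaussian_kernel.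
Context (R : realType) (d : measure_display) (X : borelMetricType R d).
Variable mu : {measure set X -> \bar R}.

Lemma open_measurable_borel (A : set X) : open A -> measurable A.
Proof. by move=> oA; rewrite measurable_borel; exact: sub_sigma_algebra. Qed.

Lemma open_ball_metric (x : X) (r : R) : open (ball x r).
Proof.
rewrite openE => y; rewrite ballEmdist/= => xy.
apply/nbhs_ballP; exists (r - mdist x y) => /=; first by rewrite subr_gt0.
move=> z; rewrite !ballEmdist /= ltrBrDl => yz.
exact: le_lt_trans (metric_triangle _ _ _) yz.
Qed.

Lemma measurable_ball (x : X) (r : R) : measurable (ball x r).
Proof. exact/open_measurable_borel/open_ball_metric. Qed.

Hypothesis ballmu : finite_positive_balls mu.

Lemma sigma_finite_balls (x : X) : sigma_finite [set: X] mu.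
Proof.
exists (fun n => ball x n.+1%:R).
  apply/esym/seteqP; split => // y _; exists (Num.truncn (mdist x y)) => //=.
  by rewrite ballEmdist/= truncnS_gt.
by move=> n; split; [exact: measurable_ball|case/andP: (ballmu x (ltr0Sn R n))].
Qed.

Definition vol (x : X) (r : R) : R := fine (mu (ball x r)).

Lemma volE x r : 0 < r -> (vol x r)%:E = mu (ball x r).
Proof. by move=> /(ballmu x)/andP[? ?]; rewrite fineK// ge0_fin_numE// ltW. Qed.

Lemma vol_gt0 x r : 0 < r -> 0 < vol x r.
Proof. by move=> r0; have := ballmu x r0; rewrite -volE// lte_fin => /andP[]. Qed.

(* Decompose the space into the shells k s <= d(z,y) < (k+1) s. *)
Lemma shell_integral (z : X) (s A q : R) (g : X -> R) (w : nat -> R) :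
  0 < s -> 0 <= A -> 0 < q < 1 -> measurable_fun setT g ->
  (forall y, 0 <= g y) -> (forall k, 0 <= w k) ->
  (forall k y, k%:R * s <= mdist z y -> mdist z y < k.+1%:R * s -> g y <= w k / vol z s) ->
  (forall k, w k * vol z (k.+1%:R * s) <= A * q ^+ k * vol z s) ->
  (\int[mu]_y (g y)%:E <= (A / (1 - q))%:E)%E.
Proof.
move=> s0 A0 q01 mg g0 w0 gw wA.
have V0 := vol_gt0 z s0.
(* The term charges the whole ball of radius (k+1)s rather than the shell: each point is still
   covered by the term of its own shell, and the measure of the ball is what [wA] controls. *)
pose b k (y : X) : \bar R := ((w k / vol z s)%:E * (\1_(ball z (k.+1%:R * s)) y)%:E)%E.
have b0 k y : (0 <= b k y)%E by rewrite mule_ge0// lee_fin divr_ge0// ltW.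
have mb k : measurable_fun setT (b k).
  by apply: measurable_funeM; exact/measurable_EFinP/measurable_indic/measurable_ball.
apply: (@le_trans _ _ (\int[mu]_y \sum_(0 <= k <oo) b k y)%E).
  apply: ge0_le_integral => //.
  - by move=> y _; rewrite lee_fin.
  - exact/measurable_EFinP.
  - exact: ge0_emeasurable_sum.
  move=> y _; pose k := Num.truncn (mdist z y / s).
  have d0 : 0 <= mdist z y / s by rewrite divr_ge0 ?mdist_ge0// ltW.
  have k1 : k%:R * s <= mdist z y by rewrite -ler_pdivlMr// truncn_le.
  have k2 : mdist z y < k.+1%:R * s by rewrite -ltr_pdivrMr// truncnS_gt.
  apply: (@le_trans _ _ (b k y)).
    rewrite /b indicE mem_set ?mule1 ?lee_fin; last by rewrite ballEmdist.
    exact: gw.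
  apply: le_trans (nneseries_lim_ge k.+1 _) => //.
  by rewrite big_nat_recr//= leeDr// sume_ge0.
rewrite integral_nneseries//; apply: nneseries_le_geometric => // k.
have ks : 0 < k.+1%:R * s by rewrite mulr_gt0.
apply/andP; split; first exact: integral_ge0.
rewrite /b ge0_integralZl//.
- rewrite integral_indic//; last exact: measurable_ball.
  by rewrite setIT -volE// -EFinM lee_fin mulrAC ler_pdivrMr.
- exact/measurable_EFinP/measurable_indic/measurable_ball.
- by rewrite lee_fin divr_ge0// ltW.
Qed.


Lemma vol_doubling : doubling mu -> exists C D : R, [/\ 0 < C, 0 < D &
  forall x r s, 0 < r -> r <= s -> vol x s <= C * (s / r) `^ D * vol x r].
Proof.
move=> [C [D [C0 D0 CD]]]; exists C, D; split => // x r s r0 rs.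
by rewrite -lee_fin EFinM !volE//; [exact: CD|exact: lt_le_trans rs].
Qed.

Lemma vol_le x y r s : 0 < r -> mdist x y + r <= s -> vol y r <= vol x s.
Proof.
move=> r0 rs; have s0 : 0 < s.
  by rewrite (lt_le_trans _ rs)// ltr_wpDl// mdist_ge0.
rewrite -lee_fin !volE//; apply: le_measure; rewrite ?inE; [exact: measurable_ball..|].
move=> z; rewrite !ballEmdist/= => yz.
by rewrite (le_lt_trans (metric_triangle x y z))// (lt_le_trans _ rs)// ltrD2l.
Qed.

Variable T : R -> X -> X -> R.
Hypotheses (doublmu : doubling mu) (Tgauss : gaussian_bound mu T).
Hypothesis Tmeas : forall t, 0 < t -> measurable_fun [set: X * X] (fun p => T t p.1 p.2).

Lemma kernel_ge0 t x y : 0 < t -> 0 <= T t x y.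
Proof. by move=> t0; have [C [c [_ _ /(_ t x y t0)/andP[]]]] := Tgauss. Qed.

Lemma measurable_kernel_l t x : 0 < t -> measurable_fun setT (T t x).
Proof. by move=> /Tmeas/(measurable_fun_pair2 x). Qed.

Lemma measurable_kernel_r t y : 0 < t -> measurable_fun setT (T t ^~ y).
Proof. by move=> /Tmeas/(measurable_fun_pair1 y). Qed.

(** The Gaussian bound is normalised by the volume at the first argument. Integrating in y, this
    volume is fixed; integrating in x, it must be compared with the volume at y, at the cost of one
    more polynomial factor. *)
Lemma gaussian_kernel_integral : exists2 K : R, 0 < K & forall t, 0 < t ->
  (forall x, (\int[mu]_y (T t x y)%:E <= K%:E)%E) /\
  (forall y, (\int[mu]_x (T t x y)%:E <= K%:E)%E).
Proof.
have [C [D [C0 D0 CD]]] := vol_doubling doublmu.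
have [B [c [B0 c0 TB]]] := Tgauss.
(* The exponent is 2D: one power D for the growth of the ball of radius (k+1)s, one for changing its
   centre. *)
have [A A0 Aq] := powR_gauss_le (addr_gt0 D0 D0) c0.
set q := expR (-1) in Aq.
have q01 : 0 < q < 1 by rewrite expR_gt0 expR_lt1 ltrN10.
pose E := B * (1 + C) * C * A.
have E0 : 0 < E by rewrite !mulr_gt0// addr_gt0.
exists (E / (1 - q)); first by rewrite divr_gt0// subr_gt0; case/andP: q01.
move=> t t0; pose s := Num.sqrt t.
have s0 : 0 < s by rewrite sqrtr_gt0.
have ss : s ^+ 2 = t by rewrite sqr_sqrtr// ltW.
(* For d(z,y) < (k+1)s the ball B(z,s) lies in B(y,(k+2)s), whence k + 2. *)
pose p k : R := k.+2%:R `^ D.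
have p1 k : 1 <= p k.
  by rewrite -[leLHS](powRr0 k.+2%:R); apply: ler_powR; [rewrite ler1n|exact: ltW].
have p0 k : 0 < p k by rewrite (lt_le_trans _ (p1 k)).
pose e k : R := expR (- (k%:R ^+ 2 / c)).
have e0 k : 0 < e k by exact: expR_gt0.
(* One weight for both integrals: in 1 + C, the 1 serves the fixed centre and the C the changed
   centre. *)
pose w k := B * (1 + C) * p k * e k.
have C10 : 0 < B * (1 + C) by rewrite mulr_gt0// addr_gt0.
have w0 k : 0 <= w k by rewrite ltW// mulr_gt0// mulr_gt0.
have wA z k : w k * vol z (k.+1%:R * s) <= E * q ^+ k * vol z s.
  have h1 : vol z (k.+1%:R * s) <= C * p k * vol z s.
    apply: (le_trans (CD z s _ s0 _)); first by rewrite ler_peMl ?ler1n// ltW.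
    rewrite mulfK ?gt_eqF// ler_wpM2r ?(ltW (vol_gt0 _ _))// ler_wpM2l ?(ltW C0)//.
    by rewrite ge0_ler_powR ?nnegrE ?(ltW D0)// ler_nat.
  apply: (le_trans (ler_wpM2l (w0 k) h1)).
  have -> : w k * (C * p k * vol z s) = B * (1 + C) * C * (p k * p k * e k) * vol z s.
    by rewrite /w; ring.
  rewrite ler_wpM2r ?(ltW (vol_gt0 _ _))// /E -[leRHS]mulrA ler_wpM2l//.
    by rewrite mulr_ge0// ltW.
  rewrite /p -powRD; first exact: Aq.
  by rewrite pnatr_eq0 implybT.
have expe k r : k%:R * s <= r -> expR (- (r ^+ 2 / (c * t))) <= e k.
  move=> kr; rewrite ler_expR lerN2 -ss ler_pdivlMr ?mulr_gt0 ?exprn_gt0//.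
  rewrite mulrA mulfVK ?gt_eqF// -exprMn ler_sqr// nnegrE.
    by rewrite mulr_ge0// ltW.
  by rewrite (le_trans _ kr)// mulr_ge0// ltW.
(* [v] stands for the inverse volume at the first kernel argument, which is z in one integral and y
   in the other. *)
have fin z v k r : k%:R * s <= r -> v <= (1 + C) * p k / vol z s ->
    B * v * expR (- (r ^+ 2 / (c * t))) <= w k / vol z s.
  move=> kr vz; apply: (@le_trans _ _ (B * ((1 + C) * p k / vol z s) * e k)).
    apply: (@le_trans _ _ (B * ((1 + C) * p k / vol z s) * expR (- (r ^+ 2 / (c * t))))).
      by rewrite ler_wpM2r ?expR_ge0// ler_wpM2l// ltW.
    rewrite ler_wpM2l ?expe// ltW// mulr_gt0// divr_gt0 ?vol_gt0// mulr_gt0//.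
    by rewrite addr_gt0.
  by rewrite /w le_eqVlt; apply/orP; left; apply/eqP; ring.
split => z.
- apply: (shell_integral (z := z) s0 (ltW E0) q01 _ _ w0 _ (wA z)).
  + exact: measurable_kernel_l.
  + by move=> y; exact: kernel_ge0.
  + move=> k y k1 k2; have /andP[_ /le_trans] := TB t z y t0; apply.
    apply: fin => //; rewrite -/(vol _ _) -/s -[leLHS]mul1r ler_wpM2r//.
      by rewrite invr_ge0 ltW// vol_gt0.
    by rewrite -[leLHS]mulr1 ler_pM// lerDl ltW.
- apply: (shell_integral (z := z) s0 (ltW E0) q01 _ _ w0 _ (wA z)).
  + exact: measurable_kernel_r.
  + by move=> y; exact: kernel_ge0.
  + move=> k y k1 k2; have /andP[_ /le_trans] := TB t y z t0; apply.
    rewrite metric_sym; apply: fin => //; rewrite -/(vol _ _) -/s.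
    rewrite ler_pdivlMr ?vol_gt0// ler_pdivrMl ?vol_gt0//.
    have zy : vol z s <= vol y (k.+2%:R * s).
      by apply: vol_le => //; rewrite metric_sym -[k.+2%:R]natr1 mulrDl mul1r lerD2r ltW.
    apply: (le_trans zy); apply: (le_trans (CD y s _ s0 _)).
      by rewrite ler_peMl ?ler1n// ltW.
    rewrite mulfK ?gt_eqF// -/(p k) mulrC ler_wpM2l ?(ltW (vol_gt0 _ _))//.
    by rewrite ler_wpM2r ?(ltW (p0 k))// lerDr.
Qed.

End gaussian_kernel.

(* The larger function need not be measurable: the integral of a nonnegative
   function is a lower integral. *)
Lemma ge0_le_lower_integral (R : realType) (d : measure_display)
    (X : measurableType d) (mu : {measure set X -> \bar R}) (f g : X -> \bar R) :
  (forall x, 0 <= f x)%E -> (forall x, f x <= g x)%E ->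
  (\int[mu]_x f x <= \int[mu]_x g x)%E.
Proof.
move=> f0 fg; have g0 x : (0 <= g x)%E by exact: le_trans (fg x).
rewrite !ge0_integralTE//; apply: le_ereal_sup => _ [h hf <-].
by exists h => // x; exact: le_trans (fg x).
Qed.

(** * Kernel operators *)

Section tonelli_sigma_finite.
Context (R : realType) (d : measure_display) (X : measurableType d).
Variable mu : {measure set X -> \bar R}.
Hypothesis sfmu : sigma_finite [set: X] mu.

(** Bundles sigma-finiteness with the measure, the form in which Tonelli's theorem applies. *)
Lemma sigma_finite_measure_of : exists nu : {sigma_finite_measure set X -> \bar R},
  mu = nu :> {measure set X -> \bar R}.
Proof.
pose H1 := isSFinite.Build _ _ _ (Measure.sort mu) (sfinite_measure_sigma_finite sfmu).
pose H2 := isSigmaFinite.Build _ _ _ (Measure.sort mu) sfmu.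
pose nu := HB.pack_for (SigmaFiniteMeasure.type X R) (Measure.sort mu) H1 H2.
by exists nu; exact: eq_measure.
Qed.

Variable f : X * X -> \bar R.
Hypotheses (mf : measurable_fun setT f) (f0 : forall p, (0 <= f p)%E).

Lemma measurable_section_integral : measurable_fun setT (fun x => \int[mu]_y f (x, y))%E.
Proof.
have [nu ->] := sigma_finite_measure_of.
exact: measurable_fun_fubini_tonelli_F.
Qed.

Lemma measurable_section_integral_r :
  measurable_fun setT (fun y => \int[mu]_x f (x, y))%E.
Proof.
have [nu ->] := sigma_finite_measure_of.
exact: (measurable_fun_fubini_tonelli_G (m1 := nu)).
Qed.

Lemma tonelli_sigma_finite :
  (\int[mu]_x \int[mu]_y f (x, y) = \int[mu]_y \int[mu]_x f (x, y))%E.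
Proof. by have [nu ->] := sigma_finite_measure_of; exact: fubini_tonelli. Qed.

End tonelli_sigma_finite.

Section kernel_operator.
Context (R : realType) (d : measure_display) (X : borelMetricType R d).
Variable mu : {measure set X -> \bar R}.
Hypothesis sfmu : sigma_finite [set: X] mu.
Variable T : R -> X -> X -> R.
Variable t : R.
Hypothesis mT : measurable_fun [set: X * X] (fun p => T t p.1 p.2).

Lemma measurable_kernel_op (u : X -> R) : measurable_fun setT u ->
  measurable_fun setT (kernel_op mu T t u).
Proof.
move=> mu_; rewrite /kernel_op /Rintegral.
pose g (p : X * X) := (T t p.1 p.2 * u p.2)%:E.
have mg : measurable_fun setT g.
  apply/measurable_EFinP/measurable_funM => //.
  exact: (measurableT_comp mu_ measurable_snd).
rewrite (_ : (fun x => _) = fine \o (fun x => \int[mu]_y g (x, y))%E)//.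
apply: (measurableT_comp (f := fine)) => //.
have gE x : (fun y => g (x, y)) = g \o pair x by [].
(* Tonelli gives measurability of the section integrals of the positive and negative parts
   separately, so no integrability is required. *)
under eq_fun do rewrite integralE gE funepos_comp funeneg_comp.
apply: emeasurable_funB.
- exact: (measurable_section_integral sfmu (measurable_funepos mg) (funepos_ge0 g)).
- exact: (measurable_section_integral sfmu (measurable_funeneg mg) (funeneg_ge0 g)).
Qed.

Lemma kernel_op_le_integral (u : X -> R) x : measurable_fun setT u ->
  (`|kernel_op mu T t u x|%:E <= \int[mu]_y `|T t x y * u y|%:E)%E.
Proof.
move=> mu_; rewrite /kernel_op /Rintegral.
have mg : measurable_fun setT (fun y => (T t x y * u y)%:E).
  apply/measurable_EFinP/measurable_funM => //.
  exact: (measurable_fun_pair2 x mT).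
apply: le_trans (le_abse_integral mu measurableT mg).
(* If the integral is infinite, [fine] returns 0 and the bound is trivial. *)
by case: (\int[mu]_x0 _)%E => [r| |]//=; rewrite normr0 leey.
Qed.

Variable K : R.
Hypotheses (K0 : 0 < K) (T0 : forall x y, 0 <= T t x y).
Hypothesis TK1 : forall x, (\int[mu]_y (T t x y)%:E <= K%:E)%E.
Hypothesis TK2 : forall y, (\int[mu]_x (T t x y)%:E <= K%:E)%E.

Lemma measurable_kernel_section x : measurable_fun setT (fun y => T t x y).
Proof. exact: (measurable_fun_pair2 x mT). Qed.

(** Weighted arithmetic-geometric mean in place of Cauchy-Schwarz: |k||u| <= k^2/(2K) + K u^2/2,
    integrated against T_t(x,y) dy, whose mass is at most [K]. The half of k^2 left on the right is
    absorbed after integration in x. *)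
Lemma kernel_op_sqr_le (u : X -> R) x : measurable_fun setT u ->
  ((kernel_op mu T t u x ^+ 2)%:E <= (kernel_op mu T t u x ^+ 2 / 2)%:E +
     (K / 2)%:E * \int[mu]_y (T t x y * u y ^+ 2)%:E)%E.
Proof.
move=> mu_; set k := kernel_op mu T t u x.
have mTx := measurable_kernel_section x.
have mu2 : measurable_fun setT (fun y => u y ^+ 2) by exact: measurable_funX.
have mTu2 : measurable_fun setT (fun y => (T t x y * u y ^+ 2)%:E).
  by apply/measurable_EFinP; exact: measurable_funM.
have mTu : measurable_fun setT (fun y => `|T t x y * u y|%:E).
  by apply/measurable_EFinP/measurableT_comp => //; exact: measurable_funM.
apply: (@le_trans _ _ (`|k|%:E * \int[mu]_y `|T t x y * u y|%:E)%E).
  rewrite -(real_normK (num_real k)) expr2 EFinM lee_wpmul2l//.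
  exact: kernel_op_le_integral.
rewrite -ge0_integralZl//.
apply: (@le_trans _ _ (\int[mu]_y ((k ^+ 2 / (2 * K))%:E * (T t x y)%:E +
    (K / 2)%:E * (T t x y * u y ^+ 2)%:E))%E).
  apply: ge0_le_integral => //.
  - exact: measurable_funeM.
  - apply: emeasurable_funD; apply: measurable_funeM => //.
    exact/measurable_EFinP.
  - move=> y _; rewrite -!EFinM -EFinD lee_fin normrM ger0_norm// -(real_normK (num_real k)).
    rewrite -(real_normK (num_real (u y))).
    (* The gap between the two sides is a nonnegative multiple of a square. *)
    have -> : `|k| ^+ 2 / (2 * K) * T t x y + K / 2 * (T t x y * `|u y| ^+ 2) =
        `|k| * (T t x y * `|u y|) + T t x y * ((`|k| - K * `|u y|) ^+ 2 / (2 * K)).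
      by field; rewrite gt_eqF.
    by rewrite lerDl mulr_ge0// divr_ge0 ?sqr_ge0// mulr_ge0// ltW.
have k2K : 0 <= k ^+ 2 / (2 * K) by rewrite divr_ge0 ?sqr_ge0// mulr_ge0// ltW.
have K2 : 0 <= K / 2 by rewrite divr_ge0// ltW.
have Tu0 y : (0 <= (T t x y * u y ^+ 2)%:E)%E by rewrite lee_fin mulr_ge0// sqr_ge0.
have mTxE : measurable_fun setT (fun y => (T t x y)%:E) by exact/measurable_EFinP.
rewrite ge0_integralD//; first last.
- exact: measurable_funeM.
- by move=> y _; rewrite mule_ge0// lee_fin.
- exact: measurable_funeM.
- by move=> y _; rewrite mule_ge0// lee_fin.
rewrite !ge0_integralZl//; last by move=> y _; rewrite lee_fin.
rewrite leeD2r//; apply: (@le_trans _ _ ((k ^+ 2 / (2 * K))%:E * K%:E)%E).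
  by rewrite lee_wpmul2l.
rewrite -EFinM lee_fin le_eqVlt; apply/orP; left; apply/eqP.
by field; rewrite gt_eqF.
Qed.

(** Integrate the pointwise estimate in x; Tonelli and the bound on integrals in x control the last
    term. Since [a] is in L^2, half of its squared norm can be subtracted from both sides. *)
Lemma schur_test (a u : X -> R) :
  a \in Lfun mu 2%:E -> u \in Lfun mu 2%:E -> a = kernel_op mu T t u %[ae mu] ->
  nrm2 mu a <= K * nrm2 mu u.
Proof.
move=> a2 u2 aE; have ma := Lfun_measurable a2; have mu_ := Lfun_measurable u2.
have mk := measurable_kernel_op mu_.
have K2 : 0 <= K / 2 by rewrite divr_ge0// ltW.
set k := kernel_op mu T t u in aE mk.
have akE : (\int[mu]_x (a x ^+ 2)%:E = \int[mu]_x (k x ^+ 2)%:E)%E.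
  apply: ae_eq_integral => //; try by apply/measurable_EFinP; exact: measurable_funX.
  by apply: filterS aE => x /= ax xT; rewrite ax.
pose g (p : X * X) := (T t p.1 p.2 * u p.2 ^+ 2)%:E.
have mg : measurable_fun setT g.
  apply/measurable_EFinP/measurable_funM => //.
  by apply: measurable_funX; exact: (measurableT_comp mu_ measurable_snd).
have g0 p : (0 <= g p)%E by rewrite lee_fin mulr_ge0// sqr_ge0.
have gK : (\int[mu]_x \int[mu]_y g (x, y) <= (K * nrm2 mu u ^+ 2)%:E)%E.
  rewrite tonelli_sigma_finite// EFinM nrm2_sqrE// -ge0_integralZl//; last 3 first.
  - by apply/measurable_EFinP; exact: measurable_funX.
  - by move=> y _; rewrite lee_fin sqr_ge0.
  - by rewrite lee_fin ltW.
  apply: ge0_le_integral => //.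
  - by move=> y _; exact: integral_ge0.
  - exact: (measurable_section_integral_r sfmu mg).
  - by apply: measurable_funeM; apply/measurable_EFinP; exact: measurable_funX.
  move=> y _; rewrite /g /=; under eq_integral do rewrite mulrC EFinM.
  rewrite ge0_integralZl//.
  + by rewrite muleC lee_wpmul2r// lee_fin sqr_ge0.
  + exact/measurable_EFinP/(measurable_fun_pair1 y mT).
  + by move=> x _; rewrite lee_fin.
  + by rewrite lee_fin sqr_ge0.
have main : ((nrm2 mu a ^+ 2)%:E <= (nrm2 mu a ^+ 2 / 2)%:E +
    (K / 2 * (K * nrm2 mu u ^+ 2))%:E)%E.
  rewrite [X in (_ <= X + _)%E]EFinM !nrm2_sqrE// akE.
  have ma2 : measurable_fun setT (fun x => (k x ^+ 2 / 2)%:E).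
    by apply/measurable_EFinP/measurable_funM => //; exact: measurable_funX.
  have mG := measurable_section_integral sfmu mg g0.
  apply: (@le_trans _ _ (\int[mu]_x ((k x ^+ 2 / 2)%:E +
      (K / 2)%:E * \int[mu]_y g (x, y)))%E).
    apply: ge0_le_integral => //.
    + by move=> x _; rewrite lee_fin sqr_ge0.
    + by apply/measurable_EFinP; exact: measurable_funX.
    + by apply: emeasurable_funD => //; exact: measurable_funeM.
    + by move=> x _; exact: kernel_op_sqr_le.
  rewrite ge0_integralD//; first last.
  - exact: measurable_funeM.
  - by move=> x _; rewrite mule_ge0 ?lee_fin ?integral_ge0.
  - by move=> x _; rewrite lee_fin divr_ge0 ?sqr_ge0.
  rewrite ge0_integralZl//; last by move=> x _; exact: integral_ge0.
  apply: leeD; last by rewrite [leRHS]EFinM lee_wpmul2l.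
  under eq_integral do rewrite EFinM.
  rewrite ge0_integralZr ?lee_fin//.
  - by apply/measurable_EFinP; exact: measurable_funX.
  - by move=> x _; rewrite lee_fin sqr_ge0.
rewrite -EFinD lee_fin in main.
rewrite -ler_sqr ?nnegrE ?nrm2_ge0//; last by rewrite mulr_ge0 ?nrm2_ge0// ltW.
rewrite exprMn; lra.
Qed.

End kernel_operator.

(** * Pairing with a bounded harmonic function *)

Section harmonic_pairing.
Context (R : realType) (d : measure_display) (X : borelMetricType R d).
Variable mu : {measure set X -> \bar R}.
Variables (L : (X -> R) -> (X -> R) -> Prop) (S : R -> (X -> R) -> (X -> R)).
Variables (T : R -> X -> X -> R).
Hypotheses (ballmu : finite_positive_balls mu) (muXoo : mu [set: X] = +oo%E)
  (doublmu : doubling mu) (Lself : selfadjoint mu L)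
  (SL : exp_semigroup mu L S) (ST : integral_kernel mu T S)
  (Tgauss : gaussian_bound mu T).

Let mT t : 0 < t -> measurable_fun [set: X * X] (fun p => T t p.1 p.2).
Proof. by move=> /ST[]. Qed.

Variable x0 : X.

Let sfmu : sigma_finite [set: X] mu := sigma_finite_balls ballmu x0.

Let Sk t f : 0 < t -> f \in Lfun mu 2%:E -> S t f = kernel_op mu T t f %[ae mu].
Proof. by move=> /ST[_]; exact. Qed.

Lemma semigroup_self_adjoint t f g : 0 < t -> f \in Lfun mu 2%:E -> g \in Lfun mu 2%:E ->
  dotL2 mu (S t f) g = dotL2 mu f (S t g).
Proof.
have [K K0 TK] := gaussian_kernel_integral ballmu doublmu Tgauss mT.
(* In 1 + K, the Schur constant [K] covers t > 0 and the 1 covers t = 0, where [S 0] is the identity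
   almost everywhere. *)
apply: (@semigroup_symmetric _ _ _ mu L S Lself SL (1 + K)) => {}t {}f t0 f2.
have S2 := semigroup_L2 SL.1 t0 f2.
have [t00|] := eqVneq t 0; last first.
  move=> tN0; have {}t0 : 0 < t by rewrite lt_def tN0.
  apply: (@le_trans _ _ (K * nrm2 mu f)).
    have [TK1 TK2] := TK t t0.
    apply: (schur_test sfmu (mT t0) K0 _ TK1 TK2) => //; last exact: Sk.
    by move=> x y; exact: (kernel_ge0 Tgauss).
  by rewrite ler_wpM2r ?nrm2_ge0// lerDr.
have -> : nrm2 mu (S t f) = nrm2 mu f.
  rewrite /nrm2; congr fine; apply: ae_eq_Lnorm;
    [exact: Lfun_measurable S2|exact: Lfun_measurable f2|].
  by rewrite t00; exact: (semigroup0 SL.1).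
by rewrite ler_peMl ?nrm2_ge0// lerDl ltW.
Qed.

(** * Truncation of h and transfer of the semigroup to the other factor *)

Variables (h : X -> R) (M : R).
Hypotheses (M0 : 0 < M) (hM : forall x, `|h x| <= M) (hharm : L_harmonic mu T h).

(** A bounded h need not lie in L^2, where symmetry is available; its restrictions to balls do,
    because balls have finite measure. *)
Definition truncation (m : nat) (x : X) : R := h x * \1_(ball x0 m%:R) x.
Local Notation hm := truncation.

Lemma truncation_le m x : `|hm m x| <= `|h x|.
Proof.
rewrite /hm normrM ler_piMr// indicE; case: (_ \in _); by rewrite ?normr1 ?normr0.
Qed.

Lemma measurable_truncation m : measurable_fun setT (hm m).
Proof.
by apply: measurable_funM; [exact: hharm.1|apply: measurable_indic; exact: measurable_ball].
Qed.

Lemma truncation_L2 m : hm m \in Lfun mu 2%:E.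
Proof.
have mhm := measurable_truncation m.
apply/LfunE; split => //; rewrite unlock poweR_lty//.
(* Radius m + 1, since finite measure is granted only for positive radii and m may be 0. *)
apply: (@le_lt_trans _ _ ((M ^+ 2)%:E * mu (ball x0 m.+1%:R))%E); last first.
  by rewrite -volE// -EFinM ltry.
rewrite -[ball _ _]setIT -integral_indic//; last exact: measurable_ball.
rewrite -ge0_integralZl//; first last.
- by rewrite lee_fin sqr_ge0.
- by apply/measurable_EFinP/measurable_indic; exact: measurable_ball.
apply: ge0_le_integral => //.
- by move=> x _; rewrite /= lee_fin powR_ge0.
- apply/measurable_EFinP/(measurableT_comp (measurable_powR _)).
  exact: measurableT_comp.
- apply: measurable_funeM.
  by apply/measurable_EFinP/measurable_indic; exact: measurable_ball.
move=> x _; rewrite -EFinM/= lee_fin powR_mulrn// /hm normrM exprMn ler_pM ?sqr_ge0//.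
  by rewrite ler_sqr// nnegrE ltW.
rewrite !indicE; case: (boolP (x \in (ball x0 m%:R : set X))) => [xm|_]; last first.
  by rewrite normr0 expr0n.
rewrite mem_set ?normr1 ?expr1n//; move: xm; rewrite inE !ballEmdist/= => /lt_trans; apply.
by rewrite ltr_nat.
Qed.

Lemma truncation_near x : \forall m \near \oo, hm m x = h x.
Proof.
exists (Num.truncn (mdist x0 x)).+1 => // m /= km.
rewrite /hm indicE mem_set ?mulr1// ballEmdist/=.
by apply: lt_le_trans (truncnS_gt _) _; rewrite ler_nat.
Qed.

Lemma kernel_op_truncation_cvg t x : 0 < t ->
  kernel_op mu T t (hm m) x @[m --> \oo] --> kernel_op mu T t h x.
Proof.
move=> t0; have [K K0 TK] := gaussian_kernel_integral ballmu doublmu Tgauss mT.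
have mTx := measurable_kernel_l mT x t0.
have Tx0 y : 0 <= T t x y := kernel_ge0 Tgauss x y t0.
pose f_ m y := (T t x y * hm m y)%:E.
pose f y := (T t x y * h y)%:E.
pose g y := (M%:E * (T t x y)%:E)%E.
have [|||||if_ _ cf] := @dominated_convergence _ _ _ mu _ measurableT f_ f g.
- move=> m; apply/measurable_EFinP/measurable_funM => //; exact: measurable_truncation.
- apply/measurable_EFinP/measurable_funM => //; exact: hharm.1.
- apply: nearW => y _; apply: cvg_near_cst.
  by apply: filterS (truncation_near y) => m hmy; rewrite /f_ hmy.
- apply: integrableZl => //; apply/integrableP; split; first exact/measurable_EFinP.
  under eq_integral do rewrite /= ger0_norm//.
  exact: le_lt_trans ((TK t t0).1 x) (ltry _).
- apply: nearW => y m _; rewrite /f_ /g -EFinM lee_fin normrM ger0_norm// mulrC.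
  by rewrite ler_wpM2r// (le_trans (truncation_le m y)).
apply: fine_cvg; rewrite fineK//.
exact: integrable_fin_num if_.
Qed.

Lemma kernel_op_bounded K t x (u : X -> R) : (\int[mu]_y (T t x y)%:E <= K%:E)%E -> 0 < t ->
  measurable_fun setT u -> (forall y, `|u y| <= M) -> `|kernel_op mu T t u x| <= M * K.
Proof.
move=> TK t0 mu_ uM; have mTx := measurable_kernel_l mT x t0.
have Tx0 y : 0 <= T t x y := kernel_ge0 Tgauss x y t0.
rewrite -lee_fin; apply: (le_trans (kernel_op_le_integral mu (mT t0) x mu_)).
apply: (@le_trans _ _ (M%:E * \int[mu]_y (T t x y)%:E)%E); last first.
  by rewrite EFinM lee_wpmul2l// lee_fin ltW.
rewrite -ge0_integralZl//; first last.
- by rewrite lee_fin ltW.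
- by move=> y _; rewrite lee_fin.
- exact/measurable_EFinP.
apply: ge0_le_integral => //.
- by apply/measurable_EFinP/measurableT_comp => //; exact: measurable_funM.
- by apply: measurable_funeM; exact/measurable_EFinP.
by move=> y _; rewrite -EFinM lee_fin normrM ger0_norm// mulrC ler_wpM2r.
Qed.

(** Replace h by T_t h, approximate it by T_t of the truncations, and move T_t onto u by symmetry in
    L^2. The limit in m is dominated by M K |u|, integrable since u is in L^1. *)
Lemma harmonic_pairing_le t u : 0 < t -> u \in Lfun mu 2%:E -> u \in Lfun mu 1 ->
  (`|\int[mu]_x (u x * h x)%:E| <= M%:E * \int[mu]_x `|kernel_op mu T t u x|%:E)%E.
Proof.
move=> t0 u2 u1; have [K K0 TK] := gaussian_kernel_integral ballmu doublmu Tgauss mT.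
have mu_ := Lfun_measurable u2; have mh := hharm.1.
have mk f : measurable_fun setT f -> measurable_fun setT (kernel_op mu T t f).
  by move=> mf; exact: measurable_kernel_op (mT t0) _ mf.
pose f_ m x := (u x * kernel_op mu T t (hm m) x)%:E.
pose f x := (u x * kernel_op mu T t h x)%:E.
pose g x := ((M * K)%:E * `|u x|%:E)%E.
have [|||||_ _ cf] := @dominated_convergence _ _ _ mu _ measurableT f_ f g.
- move=> m; apply/measurable_EFinP/measurable_funM => //.
  by apply: mk; exact: measurable_truncation.
- by apply/measurable_EFinP/measurable_funM => //; exact: mk.
- apply: nearW => x _; apply: cvg_EFin; first exact: nearW.
  by apply: cvgMr; exact: kernel_op_truncation_cvg.
- apply: integrableZl => //.
  exact: (integrable_abse ((Lfun1_integrable mu _).1 u1)).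
- apply: nearW => x m _; rewrite /f_ /g -EFinM lee_fin normrM mulrC ler_wpM2r//.
  apply: kernel_op_bounded => //; [exact: (TK t t0).1|exact: measurable_truncation|].
  by move=> y; exact: le_trans (truncation_le m y) _.
have fE : (\int[mu]_x (u x * h x)%:E = \int[mu]_x f x)%E.
  apply: ae_eq_integral => //.
  - by apply/measurable_EFinP; exact: measurable_funM.
  - by apply/measurable_EFinP/measurable_funM => //; exact: mk.
  - by apply: filterS (hharm.2 t t0) => x /= hx xT; rewrite /f hx.
rewrite fE; apply: (cvge_to_le (cvg_abse cf)); apply: nearW => m /=.
have hm2 := truncation_L2 m; have mhm := measurable_truncation m.
have St2 := semigroup_L2 SL.1 (ltW t0) u2.
have Shm2 := semigroup_L2 SL.1 (ltW t0) hm2.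
have -> : (\int[mu]_x f_ m x = \int[mu]_x (kernel_op mu T t u x * hm m x)%:E)%E.
  transitivity (dotL2 mu u (S t (hm m)))%:E.
    rewrite dotL2E//; apply: ae_eq_integral => //.
    - by apply/measurable_EFinP/measurable_funM => //; exact: mk.
    - by apply/measurable_EFinP/measurable_funM => //; exact: Lfun_measurable Shm2.
    - by apply: filterS (Sk t0 hm2) => x /= hx xT; rewrite /f_ hx.
  rewrite -semigroup_self_adjoint// dotL2E//; apply: ae_eq_integral => //.
  - by apply/measurable_EFinP/measurable_funM => //; exact: Lfun_measurable St2.
  - by apply/measurable_EFinP/measurable_funM => //; exact: mk.
  - by apply: filterS (Sk t0 u2) => x /= hx xT; rewrite hx.
apply: (le_trans (le_abse_integral _ _ _)) => //.
  by apply/measurable_EFinP/measurable_funM => //; exact: mk.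
rewrite -ge0_integralZl//; first last.
- by rewrite lee_fin ltW.
- by apply/measurable_EFinP/measurableT_comp => //; exact: mk.
apply: ge0_le_integral => //.
- by apply/measurableT_comp/measurable_EFinP/measurable_funM => //; exact: mk.
- by apply: measurable_funeM; apply/measurable_EFinP/measurableT_comp => //; exact: mk.
move=> x _; rewrite -EFinM/= lee_fin normrM mulrC ler_wpM2r//.
exact: le_trans (truncation_le m x) _.
Qed.

(** * Decay of T_t u along integer times *)

Lemma ball_sqrt_cvg x : mu (ball x (Num.sqrt n.+1%:R)) @[n --> \oo] --> +oo%E.
Proof.
rewrite -muXoo; have <- : \bigcup_n ball x (Num.sqrt n.+1%:R) = [set: X].
  apply/seteqP; split => // y _; exists (Num.truncn (mdist x y ^+ 2)) => //=.
  rewrite ballEmdist/= -[ltLHS](@ger0_norm _ (mdist x y)) ?mdist_ge0// -sqrtr_sqr.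
  by rewrite ltr_sqrt// truncnS_gt.
apply: nondecreasing_cvg_mu.
- by move=> n; exact: measurable_ball.
- by apply: bigcup_measurable => n _; exact: measurable_ball.
- move=> m n mn; apply/subsetPset => y; rewrite !ballEmdist/= => /lt_le_trans; apply.
  by rewrite ler_sqrt// ler_nat.
Qed.

Lemma kernel_op_cvg0 u x : u \in Lfun mu 1 ->
  `|kernel_op mu T n.+1%:R u x|%:E @[n --> \oo] --> 0%E.
Proof.
move=> u1; have mu_ := Lfun_measurable u1; have [B [c [B0 c0 TB]]] := Tgauss.
have iu := (Lfun1_integrable mu _).1 u1.
have /fineK I1 : (\int[mu]_y `|u y|%:E)%E \is a fin_num.
  exact: integrable_fin_num (integrable_abse iu).
set I := fine _ in I1.
have I0 : 0 <= I by apply: fine_ge0; apply: integral_ge0.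
have bound n : `|kernel_op mu T n.+1%:R u x| <=
    B * I / vol mu x (Num.sqrt n.+1%:R).
  have t0 : 0 < n.+1%:R :> R by [].
  have V0 : 0 < vol mu x (Num.sqrt n.+1%:R) by rewrite vol_gt0// sqrtr_gt0.
  have BV : 0 <= B / vol mu x (Num.sqrt n.+1%:R) by rewrite divr_ge0// ltW.
  rewrite -lee_fin; apply: (le_trans (kernel_op_le_integral mu (mT t0) x mu_)).
  rewrite mulrAC EFinM I1 -ge0_integralZl//; first last.
  - by apply/measurable_EFinP/measurableT_comp.
  apply: ge0_le_integral => //.
  - apply/measurable_EFinP/measurableT_comp => //; apply: measurable_funM => //.
    exact: (measurable_kernel_l mT x t0).
  - by apply: measurable_funeM; apply/measurable_EFinP/measurableT_comp.
  move=> y _; rewrite -EFinM lee_fin normrM ler_wpM2r//.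
  have /andP[T0 /le_trans] := TB n.+1%:R x y t0; rewrite ger0_norm//; apply.
  (* The exponential factor is at most 1; only the volume factor matters for large times. *)
  rewrite ler_piMr// -expR0 ler_expR lerNl oppr0 divr_ge0 ?sqr_ge0//.
  by rewrite mulr_ge0// ltW.
apply: cvg_EFin; first exact: nearW.
apply/cvgr0Pnorm_lt => e e0.
have /cvgeyPgt/(_ (B * I / e)) := ball_sqrt_cvg x; apply: filterS => n.
have s0 : 0 < Num.sqrt n.+1%:R :> R by rewrite sqrtr_gt0.
rewrite -volE// lte_fin ltr_pdivrMr// => Ve.
rewrite /= normr_id; apply: (le_lt_trans (bound n)).
by rewrite ltr_pdivrMr ?vol_gt0// [ltRHS]mulrC.
Qed.

(** Dominated convergence. The maximal function is a supremum over uncountably many times, with no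
    measurability at hand, so the dominating function is the supremum over integer times; its
    integral is still at most [hardy_norm], by monotonicity of the lower integral. *)
Lemma prehardy_kernel_op_cvg0 u : prehardy mu T u -> u \in Lfun mu 1 ->
  (\int[mu]_x `|kernel_op mu T n.+1%:R u x|%:E)%E @[n --> \oo] --> 0%E.
Proof.
move=> [u2 uH] u1; have mu_ := Lfun_measurable u1.
pose f_ n x := `|kernel_op mu T n.+1%:R u x|%:E.
pose g x := esups (f_ ^~ x) 0%N.
have mf n : measurable_fun setT (f_ n).
  apply/measurable_EFinP/measurableT_comp => //.
  by apply: (measurable_kernel_op sfmu (mT _)).
have mg : measurable_fun setT g by exact: measurable_fun_esups.
have fg n x : (f_ n x <= g x)%E by apply: ereal_sup_ubound; exists n.
have f0 n x : (0 <= f_ n x)%E by rewrite lee_fin.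
have g0 x : (0 <= g x)%E by exact: le_trans (f0 0%N x) (fg 0%N x).
have ig : mu.-integrable setT g.
  apply/integrableP; split => //.
  under eq_integral do rewrite gee0_abs//.
  apply: le_lt_trans uH; apply: ge0_le_lower_integral => // x.
  by apply: le_ereal_sup => _ [n _ <-]; exists n.+1%:R => //=.
have [|||||_ _] := @dominated_convergence _ _ _ mu _ measurableT f_ (cst 0%E) g.
- exact: mf.
- exact: measurable_cst.
- by apply: nearW => x _; exact: kernel_op_cvg0.
- exact: ig.
- by apply: nearW => x n _; rewrite gee0_abs.
by rewrite integral0.
Qed.

Lemma prehardy_orthogonal u : prehardy mu T u -> u \in Lfun mu 1 ->
  (\int[mu]_x (u x * h x)%:E = 0)%E.
Proof.
move=> uH u1; apply/eqP; rewrite -abse_eq0 eq_le abse_ge0 andbT.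
have cu := prehardy_kernel_op_cvg0 uH u1.
have := cvgeZl (y := M%:E) isT cu; rewrite mule0 => cMu.
apply: (cvge_ge _ cMu); apply: nearW => n.
by apply: harmonic_pairing_le => //; exact: uH.1.
Qed.

(** Pairing with the bounded function h is continuous for the L^1 norm, so vanishing passes from the
    approximants u_n to f. *)
Lemma hardy_orthogonal f : hardy mu T f -> (\int[mu]_x (f x * h x)%:E = 0)%E.
Proof.
move=> [f1 [u [uH _ uf]]]; have mh := hharm.1; have mf := Lfun_measurable f1.
have ih v : v \in Lfun mu 1 -> mu.-integrable setT (fun x => (v x * h x)%:E).
  move=> v1; have /(integrableZl measurableT M) iv := (Lfun1_integrable mu _).1 v1.
  apply: le_integrable iv => //.
    by apply/measurable_EFinP/measurable_funM => //; exact: Lfun_measurable v1.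
  move=> x _; rewrite /= lee_fin !normrM mulrC ler_wpM2r//.
  by rewrite (ger0_norm (ltW M0)).
have key : \forall n \near \oo, (`|\int[mu]_x (f x * h x)%:E| <=
    M%:E * 'N[mu]_1 [EFin \o (u n \- f)%R])%E.
  (* Once the L^1 distance is below 1, u_n - f is in L^1, hence so is u_n, and orthogonality applies
     to it. *)
  apply: filterS (cvge0_lt _ ltr01 uf) => n ufn.
  have [un2 _] := uH n; have mun := Lfun_measurable un2.
  have w1 : u n \- f \in Lfun mu 1.
    apply/LfunE; split; first exact: measurable_funB.
    by rewrite (lt_trans ufn)// ltry.
  have un1 : u n \in Lfun mu 1.
    have -> : u n = (u n \- f) + f by apply/funext => x; rewrite [RHS]/= subrK.
    exact: rpredD.
  have -> : (\int[mu]_x (f x * h x)%:E = - \int[mu]_x ((u n \- f) x * h x)%:E)%E.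
    under [in RHS]eq_integral do rewrite /= mulrBl EFinB.
    rewrite integralB//; [|exact: ih|exact: ih].
    by rewrite (prehardy_orthogonal (uH n) un1) add0e oppeK.
  rewrite abseN Lnorm1 -ge0_integralZl//; first last.
  - by rewrite lee_fin ltW.
  - by apply/measurableT_comp/measurable_EFinP/measurable_funB.
  have mwh := measurable_int mu (ih _ w1).
  apply: (le_trans (le_abse_integral _ _ mwh)) => //.
  apply: ge0_le_integral => //.
  - exact: measurableT_comp.
  - by apply/measurable_funeM/measurableT_comp/measurable_EFinP/measurable_funB.
  by move=> x _; rewrite -EFinM/= lee_fin normrM mulrC ler_wpM2r.
have := cvgeZl (y := M%:E) isT uf; rewrite mule0 => cM.
by apply/eqP; rewrite -abse_eq0 eq_le abse_ge0 andbT; exact: cvge_ge key cM.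
Qed.

End harmonic_pairing.

(* muXoo excludes a degenerate case: when mu(X) is finite, a bounded harmonic h
   satisfies h \in H^1_L, so the conclusion fails unless h = 0 almost everywhere
   (e.g. X a point, L = 0, f = h = 1). *)
Theorem corollary4p2 (R : realType) (d : measure_display)
    (X : borelMetricType R d) (mu : {measure set X -> \bar R})
    (L : (X -> R) -> (X -> R) -> Prop)
    (S : R -> (X -> R) -> (X -> R))
    (T : R -> X -> X -> R) (h : X -> R)
    (ballmu : finite_positive_balls mu)
    (muXoo : mu [set: X] = +oo%E)
    (doublmu : doubling mu)
    (Lself : selfadjoint mu L)
    (Lge0 : nonnegative mu L)
    (SL : exp_semigroup mu L S)
    (ST : integral_kernel mu T S)
    (Tgauss : gaussian_bound mu T)
    (hbounded : exists M : R, forall x, `|h x| <= M)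
    (hharm : L_harmonic mu T h) :
  forall f : X -> R, hardy mu T f -> (\int[mu]_x (f x * h x)%:E = 0)%E.
Proof.
(* Infinite total measure forces X to be nonempty, which provides the centre of the truncating
   balls. *)
have /set0P[x0 _] : [set: X] != set0.
  by apply/eqP => X0; move: muXoo; rewrite X0 measure0.
have [M hM] := hbounded => f.
have M1 : 0 < 1 + `|M| by rewrite ltr_pwDl.
apply: (hardy_orthogonal ballmu muXoo doublmu Lself SL ST Tgauss x0 M1 _ hharm) => x.
by rewrite (le_trans (hM x))// (le_trans (ler_norm M))// lerDr.
Qed.
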